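(* Let a network $P$ (with matrices $A,B_1,B_2,C_1,C_2,D_1,D_{12},D_{21},D_2$), a consensus matrix $N$ and a class $\mathcal{O}_{m,L}$ be given such that Assumptions 1 and 2 below hold, and let $K$ be a controller with matrices $(A_c,B_c,C_c,D_c)$. Suppose that the interconnection of $F$ and $P\star K$ is well-posed for all $F\in\mathcal{O}_{m,L}$. Then the algorithm $F\star(P\star K)$ is convergent for all $F\in\mathcal{O}_{m,L}$ if and only if the following two conditions are satisfied: 1. (Robust Stability) $I-D_2D_c$ is invertible and, for all $\tilde F\in\mathcal{O}^0_{m,L}$, the interconnection $\tilde F\star(P\star K)$ is well-posed and satisfies $\lim_{k\to\infty}(x^N_k,\xi_k)=0$ for all initial states $(x^N_0,\xi_0)$. 2. (Regulator Equations) There exists a unique tuple of matrices $(\Pi,\Theta,\Gamma,\Phi)$ with $$A\Pi+(0\ \ B_1N)+B_2\Gamma=\Pi,\qquad C_1\Pi+(\mathbf{1}_s\otimes I_c\ \ D_1N)+D_{12}\Gamma=0,\qquad C_2\Pi+(0\ \ D_{21}N)+D_2\Gamma=\Phi,$$ $$A_c\Theta+B_c\Phi=\Theta,\qquad C_c\Theta+D_c\Phi=\Gamma.$$ Moreover, if conditions 1 and 2 hold, then for every $F\in\mathcal{O}_{m,L}$ with optimal solution $(\beta^*,w^* )$, $w^*=N\hat w^*$, and for all initial conditions $(x_0^N,\xi_0)$, $$\lim_{k\to\infty}\begin{pmatrix}x_k^N\\ \xi_k\\ y_k\\ u_k\end{pmatrix}=\begin{pmatrix}\Pi\\ \Theta\\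 \Phi\\ \Gamma\end{pmatrix}\begin{pmatrix}-\beta^*\\ \hat w^*\end{pmatrix},\qquad \lim_{k\to\infty}\begin{pmatrix}z_k\\ w_k\end{pmatrix}=\begin{pmatrix}\mathbf{1}_s\otimes\beta^*\\ N\hat w^*\end{pmatrix}.$$
   Context: Function classes. Let $\mathbf{q}(x)=\frac12\|x\|^2$ on $\mathbb{R}^c$. For $m\in\mathbb{R}$, $L\in(m,\infty]$, $\mathcal{S}_{m,L}$ is the class of $f:\mathbb{R}^c\to\mathbb{R}\cup\{\pm\infty\}$ such that $f-m\mathbf{q}$ is proper, convex and closed (p.c.c.) and, if $L<\infty$, also $L\mathbf{q}-f$ is p.c.c.; $\partial f:=\partial(f-m\mathbf{q})+mI$ with the convex subdifferential on the right. Fix $s,c\ge1$ and $m=(m_1,\dots,m_s)$, $L=(L_1,\dots,L_s)$ with $m_i\in\mathbb{R}$, $L_i\in(m_i,\infty]$, $\sum_i m_i>0$. $\mathcal{O}_{m,L}$ is the class of operators $F:\mathbb{R}^{sc}\rightrightarrows\mathbb{R}^{sc}$, $F(z)=\partial f_1(z^1)\times\cdots\times\partial f_s(z^s)$ with $f_i\in\mathcal{S}_{m_i,L_i}$, for which there is a unique pair (''optimal solution'') $(\beta^*,w^* )\in\mathbb{R}^c\times\mathbb{R}^{sc}$ with $\sum_i w_i^*=0$, $w_i^*\in\partial f_i(\beta^* )$ for all $i$. $\mathcal{O}_{m,L}^0$ is the subset of $F\in\mathcal{O}_{m,L}$ with $f_i(0)=0$ for all $i$ and $0\in F(0)$. Consensus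 matrix: $N\in\mathbb{R}^{sc\times(s-1)c}$ with $\mathrm{rank}(N)=(s-1)c$ and $\mathrm{ran}(N)=\mathrm{null}((\mathbf{1}_s\otimes I_c)^\top)$ (empty if $s=1$). Interconnection. The network $P$ is $x^N_{k+1}=Ax^N_k+B_1w_k+B_2u_k$, $z_k=C_1x^N_k+D_1w_k+D_{12}u_k$, $y_k=C_2x^N_k+D_{21}w_k+D_2u_k$ with $w_k,z_k\in\mathbb{R}^{sc}$, $u_k\in\mathbb{R}^{n_u}$, $y_k\in\mathbb{R}^{n_y}$; the controller $K$ is $\xi_{k+1}=A_c\xi_k+B_cy_k$, $u_k=C_c\xi_k+D_cy_k$. $P\star K$ is well-posed if $I-D_2D_c$ is invertible; eliminating $(u,y)$ gives $x_{k+1}=\mathcal{A}x_k+\mathcal{B}w_k$, $z_k=\mathcal{C}x_k+\mathcal{D}w_k$ with $x_k=(x^N_k,\xi_k)$ and $\mathcal{D}=D_1+D_{12}D_c(I-D_2D_c)^{-1}D_{21}$. The algorithm $F\star(P\star K)$ is this system together with $w_k\in F(z_k)$. It is well-posed if $P\star K$ is well-posed and $(F^{-1}-\mathcal{D})^{-1}$ is globally continuous, i.e. single-valued everywhere on $\mathbb{R}^{sc}$ (exactly one element) and continuous. Here $F^{-1}(x)=\{y\mid x\in F(y)\}$. Convergent. A fixed point is $(x^*,z^*,w^* )$ with $x^*=\mathcal{A}x^*+\mathcal{B}w^*$, $z^*=\mathcal{C}x^*+\mathcal{D}w^*$, $w^*\in F(z^* )$. The algorithm is convergent (a convergent optimization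 algorithm) if there is a fixed point with $z^*=\mathbf{1}_s\otimes\beta^*$, $(\mathbf{1}_s\otimes I_c)^\top w^*=0$ and $\lim_{k\to\infty}(x_k,w_k,z_k)=(x^*,w^*,z^* )$ for all initial states $x_0$. Assumptions. Put $\mathbf{m}:=\mathrm{diag}(m)\otimes I_c$. Assumption 1: $E(\mathbf{m}):=I-D_1\mathbf{m}$ is invertible. Assumption 2: with $A^{\mathbf m}=A+B_1\mathbf{m}E(\mathbf{m})^{-1}C_1$, $B_2^{\mathbf m}=B_2+B_1\mathbf{m}E(\mathbf{m})^{-1}D_{12}$, $C_2^{\mathbf m}=C_2+D_{21}\mathbf{m}E(\mathbf{m})^{-1}C_1$, the pair $(A^{\mathbf m},B_2^{\mathbf m})$ is stabilizable and $(A^{\mathbf m},C_2^{\mathbf m})$ is detectable (discrete time). *)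

(* Defs.v *)
From HB Require Import structures.
From mathcomp Require Import all_boot all_order all_algebra.
From mathcomp Require Import all_classical all_reals all_analysis.
From mathcomp Require Import complex mxtens.

Set Implicit Arguments.
Unset Strict Implicit.
Unset Printing Implicit Defensive.

Import Order.TTheory GRing.Theory Num.Theory.
Import numFieldNormedType.Exports.

Local Open Scope classical_set_scope.
Local Open Scope ring_scope.

Section FunctionClasses.
Variable R : realType.

(* The norm of the library on matrices is the sup norm, so the Euclidean
   structure is written out. *)
Definition dotv n (u v : 'cV[R]_n) : R := \sum_i u i 0 * v i 0.

Definition qform n (x : 'cV[R]_n) : R := 2^-1 * dotv x x.

Definition epigraph n (f : 'cV[R]_n -> \bar R) : set ('cV[R]_n * R^o) :=
  [set p | (f p.1 <= (p.2)%:E)%E].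

Definition proper n (f : 'cV[R]_n -> \bar R) : Prop :=
  (forall x, f x != -oo%E) /\ (exists x, f x != +oo%E).

Definition pcc n (f : 'cV[R]_n -> \bar R) : Prop :=
  [/\ proper f, convex_set (epigraph f) & closed (epigraph f)].

Definition classS n (m : R) (L : \bar R) (f : 'cV[R]_n -> \bar R) : Prop :=
  pcc (fun x => f x - (m * qform x)%:E)%E /\
  (forall l : R, L = l%:E -> pcc (fun x => (l * qform x)%:E - f x)%E).

(* If g is proper, this is empty at every x with g x = +oo. *)
Definition convex_subdiff n (g : 'cV[R]_n -> \bar R) (x : 'cV[R]_n) :
    set 'cV[R]_n :=
  [set h | forall y, (g x + (dotv h (y - x))%:E <= g y)%E].

Definition subdiff n (m : R) (f : 'cV[R]_n -> \bar R) (x : 'cV[R]_n) :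
    set 'cV[R]_n :=
  [set h + m *: x | h in convex_subdiff (fun y => f y - (m * qform y)%:E)%E x].

End FunctionClasses.

Definition operator (R : realType) (q : nat) := 'cV[R]_q -> set 'cV[R]_q.

Section OperatorClasses.
Variables (R : realType) (s c : nat).

Definition blk (i : 'I_s) (z : 'cV[R]_(s * c)) : 'cV[R]_c :=
  \col_j z (mxtens_index (i, j)) 0.

(* The matrix 1_s (x) I_c; the cast identifies 1 * c with c. *)
Definition onesI : 'M[R]_(s * c, c) :=
  castmx (erefl (s * c)%N, mul1n c)
    ((const_mx 1 : 'cV[R]_s) *t (1%:M : 'M[R]_c)).

(* 1_s (x) beta *)
Definition stack (beta : 'cV[R]_c) : 'cV[R]_(s * c) := onesI *m beta.

Definition separable_subdiff (m : 'I_s -> R)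
    (f : 'I_s -> 'cV[R]_c -> \bar R) : operator R (s * c) :=
  fun z => [set w | forall i, subdiff (m i) (f i) (blk i z) (blk i w)].

(* For F = separable_subdiff m f, the second conjunct says that the i-th block
   of w belongs to the subdifferential of f_i at beta, for all i. *)
Definition optimal_solution (F : operator R (s * c))
    (beta : 'cV[R]_c) (w : 'cV[R]_(s * c)) : Prop :=
  \sum_i blk i w = 0 /\ F (stack beta) w.

Definition has_unique_optimum (F : operator R (s * c)) : Prop :=
  exists! p : 'cV[R]_c * 'cV[R]_(s * c), optimal_solution F p.1 p.2.

Definition classO (m : 'I_s -> R) (L : 'I_s -> \bar R) :
    set (operator R (s * c)) :=
  [set F | exists f : 'I_s -> 'cV[R]_c -> \bar R,
    [/\ forall i, classS (m i) (L i) (f i),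
        F = separable_subdiff m f
      & has_unique_optimum F]].

Definition classO0 (m : 'I_s -> R) (L : 'I_s -> \bar R) :
    set (operator R (s * c)) :=
  [set F | exists f : 'I_s -> 'cV[R]_c -> \bar R,
    [/\ forall i, classS (m i) (L i) (f i),
        F = separable_subdiff m f,
        has_unique_optimum F,
        forall i, f i 0 = 0%E
      & F 0 0]].

(* ran(N) = null((1_s (x) I_c)^T) with N of full column rank *)
Definition consensus_matrix (N : 'M[R]_(s * c, s.-1 * c)) : Prop :=
  \rank N = (s.-1 * c)%N /\
  range (fun v : 'cV[R]_(s.-1 * c) => N *m v) = [set w | onesI^T *m w = 0].

(* diag(m) (x) I_c *)
Definition mbold (m : 'I_s -> R) : 'M[R]_(s * c) :=
  diag_mx (\row_i m i) *t (1%:M : 'M[R]_c).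

End OperatorClasses.

Section Interconnection.
Variable R : realType.

Record network (n q nu ny : nat) := Network {
  nA : 'M[R]_n;       nB1 : 'M[R]_(n, q);  nB2 : 'M[R]_(n, nu);
  nC1 : 'M[R]_(q, n); nD1 : 'M[R]_q;       nD12 : 'M[R]_(q, nu);
  nC2 : 'M[R]_(ny, n); nD21 : 'M[R]_(ny, q); nD2 : 'M[R]_(ny, nu) }.

Record controller (nc nu ny : nat) := Controller {
  kA : 'M[R]_nc;       kB : 'M[R]_(nc, ny);
  kC : 'M[R]_(nu, nc); kD : 'M[R]_(nu, ny) }.

Variables (n q nu ny nc : nat).
Variables (P : network n q nu ny) (K : controller nc nu ny).

Definition network_eqs (xN : nat -> 'cV[R]_n) (w z : nat -> 'cV[R]_q)
    (u : nat -> 'cV[R]_nu) (y : nat -> 'cV[R]_ny) : Prop :=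
  forall k,
  [/\ xN k.+1 = nA P *m xN k + nB1 P *m w k + nB2 P *m u k,
      z k = nC1 P *m xN k + nD1 P *m w k + nD12 P *m u k
    & y k = nC2 P *m xN k + nD21 P *m w k + nD2 P *m u k].

Definition controller_eqs (xi : nat -> 'cV[R]_nc)
    (y : nat -> 'cV[R]_ny) (u : nat -> 'cV[R]_nu) : Prop :=
  forall k,
  xi k.+1 = kA K *m xi k + kB K *m y k /\ u k = kC K *m xi k + kD K *m y k.

Definition loop_well_posed : Prop := 1%:M - nD2 P *m kD K \in unitmx.

(* Elimination of (u, y) with M = (I - D2 Dc)^-1:
     y = M (C2 xN + D2 Cc xi + D21 w)   and   u = Cc xi + Dc y. *)
Let M := invmx (1%:M - nD2 P *m kD K).
Let Yx : 'M[R]_(ny, n + nc) := row_mx (M *m nC2 P) (M *m nD2 P *m kC K).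
Let Yw : 'M[R]_(ny, q) := M *m nD21 P.
Let Ux : 'M[R]_(nu, n + nc) := row_mx 0 (kC K) + kD K *m Yx.
Let Uw : 'M[R]_(nu, q) := kD K *m Yw.

Definition clA : 'M[R]_(n + nc) :=
  col_mx (row_mx (nA P) 0 + nB2 P *m Ux) (row_mx 0 (kA K) + kB K *m Yx).
Definition clB : 'M[R]_(n + nc, q) :=
  col_mx (nB1 P + nB2 P *m Uw) (kB K *m Yw).
Definition clC : 'M[R]_(q, n + nc) := row_mx (nC1 P) 0 + nD12 P *m Ux.
Definition clD : 'M[R]_q := nD1 P + nD12 P *m Uw.

Variable F : operator R q.

(* The operator (F^-1 - D)^-1: it maps v to the set of all w such that
   v = z - D w for some z in F^-1(w), that is, for some z with w in F(z). *)
Definition inv_op (G : operator R q) : operator R q := fun x => [set y | G y x].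

Definition sub_mx_op (G : operator R q) (D : 'M[R]_q) : operator R q :=
  fun w => [set z - D *m w | z in G w].

Definition loop_resolvent : operator R q := inv_op (sub_mx_op (inv_op F) clD).

Definition well_posed : Prop :=
  loop_well_posed /\
  exists2 g : 'cV[R]_q -> 'cV[R]_q,
    forall v, loop_resolvent v = [set g v] & continuous g.

Definition trajectory (x : nat -> 'cV[R]_(n + nc)) (w z : nat -> 'cV[R]_q) :
    Prop :=
  forall k, [/\ x k.+1 = clA *m x k + clB *m w k,
                z k = clC *m x k + clD *m w k
              & F (z k) (w k)].

Definition fixed_point (x : 'cV[R]_(n + nc)) (w z : 'cV[R]_q) : Prop :=
  [/\ x = clA *m x + clB *m w, z = clC *m x + clD *m w & F z w].

End Interconnection.

Section Theory.
Variables (R : realType) (s c n nu ny nc : nat).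
Variables (P : network R n (s * c) nu ny) (K : controller R nc nu ny).

Definition convergent (F : operator R (s * c)) : Prop :=
  exists xs ws zs,
  [/\ fixed_point P K F xs ws zs,
      (exists beta, zs = stack s beta),
      (onesI R s c)^T *m ws = 0
    & forall x w z, trajectory P K F x w z ->
        [/\ x k @[k --> \oo] --> xs,
            w k @[k --> \oo] --> ws
          & z k @[k --> \oo] --> zs]].

Definition schur_stable p (A : 'M[R]_p) : Prop :=
  forall l : R[i], eigenvalue (map_mx (real_complex R) A) l -> `|l| < 1.

Definition stabilizable p r (A : 'M[R]_p) (B : 'M[R]_(p, r)) : Prop :=
  exists G : 'M[R]_(r, p), schur_stable (A + B *m G).

Definition detectable p r (A : 'M[R]_p) (C : 'M[R]_(r, p)) : Prop :=
  exists G : 'M[R]_(p, r), schur_stable (A + G *m C).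

Definition Emx (m : 'I_s -> R) : 'M[R]_(s * c) :=
  1%:M - nD1 P *m mbold c m.

Definition shift_invertible (m : 'I_s -> R) : Prop := Emx m \in unitmx.

Definition shift_stabilizable_detectable (m : 'I_s -> R) : Prop :=
  let S := mbold c m *m invmx (Emx m) in
  let Am := nA P + nB1 P *m S *m nC1 P in
  let B2m := nB2 P + nB1 P *m S *m nD12 P in
  let C2m := nC2 P + nD21 P *m S *m nC1 P in
  stabilizable Am B2m /\ detectable Am C2m.

Definition robust_stability (m : 'I_s -> R) (L : 'I_s -> \bar R) : Prop :=
  loop_well_posed P K /\
  forall F, classO0 m L F ->
    well_posed P K F /\
    forall x w z, trajectory P K F x w z -> x k @[k --> \oo] --> (0 : 'cV[R]_(n + nc)).

Definition regulator_eqs (N : 'M[R]_(s * c, s.-1 * c))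
    (Pi : 'M[R]_(n, c + s.-1 * c)) (Theta : 'M[R]_(nc, c + s.-1 * c))
    (Gamma : 'M[R]_(nu, c + s.-1 * c)) (Phi : 'M[R]_(ny, c + s.-1 * c)) :
    Prop :=
  [/\ nA P *m Pi + row_mx 0 (nB1 P *m N) + nB2 P *m Gamma = Pi,
      nC1 P *m Pi + row_mx (onesI R s c) (nD1 P *m N) + nD12 P *m Gamma = 0,
      nC2 P *m Pi + row_mx 0 (nD21 P *m N) + nD2 P *m Gamma = Phi,
      kA K *m Theta + kB K *m Phi = Theta
    & kC K *m Theta + kD K *m Phi = Gamma].

Definition regulator_condition (N : 'M[R]_(s * c, s.-1 * c)) : Prop :=
  exists! X : 'M[R]_(n, c + s.-1 * c) * 'M[R]_(nc, c + s.-1 * c)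
            * 'M[R]_(nu, c + s.-1 * c) * 'M[R]_(ny, c + s.-1 * c),
    let: (Pi, Theta, Gamma, Phi) := X in regulator_eqs N Pi Theta Gamma Phi.

End Theory.

(* Main.v *)
Require Import Defs.
From HB Require Import structures.
From mathcomp Require Import all_boot all_order all_algebra.
From mathcomp Require Import all_classical all_reals all_analysis.
From mathcomp Require Import complex mxtens ring lra.

(** The class O_{m,L} is invariant under translations: replacing each f_i by
    f_i(. + beta) - <w_i, .> + a_i, with the w_i summing to zero, stays in the
    class and moves the optimal solution by (- beta, - w).  At the optimal
    solution of F, with the a_i chosen to make the new functions vanish at 0,
    the result belongs to O^0_{m,L}; see [classO_shift], [classO0_shift].

    Conditions 1 and 2 imply convergence.  The regulator equations are, after
    elimination of (u, y), linear equations saying that the image of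
    (- beta, w_hat) is a closed-loop equilibrium with z = 1 (x) beta and
    w = N w_hat ([regulator_eqsE], [regulator_fixed_point]).  Subtracting this
    equilibrium from a trajectory of F leaves a trajectory of the translated
    operator in O^0 ([trajectory_shift]), so robust stability sends the state
    to the equilibrium.  The signals w and z follow because well-posedness makes
    w a continuous function of the state, and y, u are linear in (x, w).

    Convergence implies condition 1.  For F in O^0 the zero trajectory exists,
    so the common limit of all trajectories is 0 ([convergent_robust]).

    Convergence implies condition 2.  The quadratics f_i = m_i q give a member
    of O^0, whose optimum is unique because the m_i have positive sum.  Its
    translates lie in O and realize every pair (beta, w) with the w_i summing to
    zero as optimal solution.  Convergence of such a translate produces an
    equilibrium state for that pair, and this state is unique, since another one
    would give a constant trajectory with another limit
    ([convergent_fixed_point]).  Unique solvability of a linear equation for each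
    exogenous vector is unique solvability of the matrix equation, column by
    column ([exists_unique_by_columns]). *)

Set Implicit Arguments.
Unset Strict Implicit.
Unset Printing Implicit Defensive.

Import Order.TTheory GRing.Theory Num.Theory.
Import numFieldNormedType.Exports.

Local Open Scope classical_set_scope.
Local Open Scope ring_scope.

(** * Convergence of matrices, entry by entry *)

Section Convergence.
Variable R : realType.

Lemma cvg_mx (T : Type) (F : set_system T) (FF : Filter F) p r
    (f : T -> 'M[R]_(p, r)) (M : 'M[R]_(p, r)) :
  (forall i j, f x i j @[x --> F] --> M i j) -> f x @[x --> F] --> M.
Proof.
move=> fM A [Q nQ sQA].
have : \forall x \near F, forall ij, Q ij.1 ij.2 (f x ij.1 ij.2).
  by apply: filter_forall => -[i j]; exact: fM (nQ i j).
by apply: filterS => x Qx; apply: sQA => i j; exact: (Qx (i, j)).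
Qed.

Lemma cvg_coord (T : Type) (F : set_system T) p r (f : T -> 'M[R]_(p, r))
    (M : 'M[R]_(p, r)) i j :
  f x @[x --> F] --> M -> f x i j @[x --> F] --> M i j.
Proof. by move=> fM; exact: (cvg_comp _ _ fM (@coord_continuous _ _ _ i j M)). Qed.

Lemma cvg_addmx (T : Type) (F : set_system T) (FF : Filter F) p r
    (f g : T -> 'M[R]_(p, r)) (M N : 'M[R]_(p, r)) :
  f x @[x --> F] --> M -> g x @[x --> F] --> N ->
  f x + g x @[x --> F] --> M + N.
Proof.
move=> fM gN; apply: cvg_mx => i j; rewrite mxE.
under eq_cvg do rewrite mxE.
by apply: cvgD; exact: cvg_coord.
Qed.

Lemma cvg_mulmxr (T : Type) (F : set_system T) (FF : Filter F) p q r
    (A : 'M[R]_(p, q)) (f : T -> 'M[R]_(q, r)) (M : 'M[R]_(q, r)) :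
  f x @[x --> F] --> M -> A *m f x @[x --> F] --> A *m M.
Proof.
move=> fM; apply: cvg_mx => i j; rewrite mxE.
under eq_cvg do rewrite mxE.
apply: cvg_big; first exact: add_continuous.
by move=> k _; apply: cvgM; [exact: cvg_cst | exact: cvg_coord].
Qed.

Lemma cvg_col_mx (T : Type) (F : set_system T) (FF : Filter F) p q r
    (f : T -> 'M[R]_(p, r)) (g : T -> 'M[R]_(q, r))
    (M : 'M[R]_(p, r)) (N : 'M[R]_(q, r)) :
  f x @[x --> F] --> M -> g x @[x --> F] --> N ->
  col_mx (f x) (g x) @[x --> F] --> col_mx M N.
Proof.
move=> fM gN; apply: cvg_mx => i j.
case: (split_ordP i) => k ->; rewrite ?col_mxEu ?col_mxEd.
  by under eq_cvg do rewrite col_mxEu; exact: cvg_coord.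
by under eq_cvg do rewrite col_mxEd; exact: cvg_coord.
Qed.

Lemma cst_cvg_mx p r (M N : 'M[R]_(p, r)) :
  ((fun=> M) : nat -> _) k @[k --> \oo] --> N -> M = N.
Proof.
move=> MN; apply/matrixP => i j.
have MNij := @cvg_coord _ _ _ _ _ _ i j MN.
by apply/esym; rewrite -(cvg_lim _ MNij) ?lim_cst.
Qed.

End Convergence.

(** * The Euclidean inner product *)

Section Dot.
Variables (R : realType) (n : nat).
Implicit Types (x y h : 'cV[R]_n).

Lemma dotvC x y : dotv x y = dotv y x.
Proof. by apply: eq_bigr => i _; rewrite mulrC. Qed.

Lemma dotvDl x y h : dotv (x + y) h = dotv x h + dotv y h.
Proof. by rewrite -big_split; apply: eq_bigr => i _; rewrite mxE mulrDl. Qed.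

Lemma dotvZl a x h : dotv (a *: x) h = a * dotv x h.
Proof. by rewrite mulr_sumr; apply: eq_bigr => i _; rewrite mxE mulrA. Qed.

Lemma dotvNl x h : dotv (- x) h = - dotv x h.
Proof. by rewrite -scaleN1r dotvZl mulN1r. Qed.

Lemma dotvDr h x y : dotv h (x + y) = dotv h x + dotv h y.
Proof. by rewrite dotvC dotvDl !(dotvC h). Qed.

Lemma dotvZr a h x : dotv h (a *: x) = a * dotv h x.
Proof. by rewrite dotvC dotvZl dotvC. Qed.

Lemma dotvNr h x : dotv h (- x) = - dotv h x.
Proof. by rewrite dotvC dotvNl dotvC. Qed.

Lemma dotv0l h : dotv 0 h = 0.
Proof. by rewrite -(scale0r 0) dotvZl mul0r. Qed.

Lemma dotv0r h : dotv h 0 = 0.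
Proof. by rewrite dotvC dotv0l. Qed.

Lemma dotv_ge0 x : 0 <= dotv x x.
Proof. by apply: sumr_ge0 => i _; rewrite -expr2 sqr_ge0. Qed.

Lemma dotv_eq0 x : dotv x x <= 0 -> x = 0.
Proof.
move=> x0; have /eqP : dotv x x = 0 by apply/le_anti; rewrite x0 dotv_ge0.
rewrite psumr_eq0 => [/allP /= z|i _]; last by rewrite -expr2 sqr_ge0.
apply/colP => i; rewrite mxE; apply/eqP.
by have := z i (mem_index_enum i); rewrite mulf_eq0 orbb.
Qed.

Lemma qformD x y : qform (x + y) = qform x + dotv y x + qform y.
Proof. by rewrite /qform dotvDl !dotvDr (dotvC x y); lra. Qed.

Lemma dotv_cvg (T : Type) (F : set_system T) (FF : Filter F)
    (f g : T -> 'cV[R]_n) x y :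
  f t @[t --> F] --> x -> g t @[t --> F] --> y ->
  dotv (f t) (g t) @[t --> F] --> dotv x y.
Proof.
move=> fx gy; apply: cvg_big; first exact: add_continuous.
by move=> i _; apply: cvgM; exact: cvg_coord.
Qed.

End Dot.

(** * Closed convex functions *)

Section FunctionClass.
Local Open Scope convex_scope.
Variables (R : realType) (n : nat).
Implicit Types (f g : 'cV[R]_n -> \bar R) (b h w x : 'cV[R]_n) (a t m : R).

(** The epigraph of the new function is the preimage of the epigraph of [g]
    under a continuous affine map, and such preimages preserve convexity and
    closedness. *)
Lemma pcc_shift g b h a :
  pcc g -> pcc (fun x => g (x + b)%R + (dotv h x + a)%:E)%E.
Proof.
case=> -[gNy [x0 gx0]] cg clg.
pose phi (p : 'cV[R]_n * R^o) : 'cV[R]_n * R^o :=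
  (p.1 + b, p.2 - (dotv h p.1 + a)).
have epi : epigraph (fun x => g (x + b)%R + (dotv h x + a)%:E)%E =
    phi @^-1` epigraph g.
  by apply/seteqP; split => -[x r] /=;
    rewrite /epigraph /phi /= EFinB leeBrDr.
split.
- split=> [x|]; last first.
    exists (x0 - b); rewrite subrK; move: gx0.
    by case: (g x0).
  by have := gNy (x + b); case: (g (x + b)).
- rewrite epi => p q l; rewrite !inE /= => pe qe.
  have -> : phi (p <| l |> q) = 
      (phi p : convex_lmodType ('cV[R]_n * R^o)%type) <| l |> phi q.
    rewrite /phi /conv /=; congr (_, _).
      by apply/colP => i; rewrite !mxE /unstable.onem; ring.
    rewrite dotvDr !dotvZr /unstable.onem /= /GRing.scale /= /GRing.scale /=.
    by ring.
  by have := cg _ _ l (mem_set pe) (mem_set qe); rewrite inE.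
- rewrite epi; apply: preimage_closed clg => p _.
  apply: (@cvg_pair _ _ _ _ (nbhs (p.1 + b))
    (nbhs (p.2 - (dotv h p.1 + a) : R^o)) _ _ _ (fun p => p.1 + b)
    (fun p => p.2 - (dotv h p.1 + a) : R^o)).
    by apply: cvg_addmx; [exact: cvg_fst | exact: cvg_cst].
  apply: cvgB; first exact: cvg_snd.
  apply: cvgD; last exact: cvg_cst.
  by apply: dotv_cvg; [exact: cvg_cst | exact: cvg_fst].
Qed.

Lemma pcc_quadratic a : 0 <= a -> pcc (fun x : 'cV[R]_n => (a * qform x)%:E).
Proof.
move=> a0; split.
- by split=> [//|]; exists 0.
- move=> p q l; rewrite !inE /epigraph /= !lee_fin /qform => pe qe.
  (* The convexity gap at the weight l is l (1 - l) a q(p.1 - q.1). *)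
  have l0 : 0 <= l%:num by [].
  have l1 : 0 <= 1 - l%:num by rewrite subr_ge0.
  rewrite /unstable.onem /GRing.scale /= dotvDl !dotvDr !dotvZl !dotvZr.
  rewrite (dotvC q.1 p.1).
  have := mulr_ge0 a0 (mulr_ge0 (mulr_ge0 l0 l1) (dotv_ge0 (p.1 - q.1))).
  have := ler_wpM2l l0 pe; have := ler_wpM2l l1 qe.
  rewrite dotvDl !dotvDr !dotvNl !dotvNr (dotvC q.1 p.1); lra.
- have -> : epigraph (fun x : 'cV[R]_n => (a * qform x)%:E) =
      (fun p : 'cV[R]_n * R^o => a * qform p.1 - p.2) @^-1` [set r | r <= 0].
    by apply/seteqP; split => p; rewrite /epigraph /= lee_fin subr_le0.
  apply: preimage_closed (@closed_le _ 0) => p _.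
  apply: cvgB; last exact: cvg_snd.
  apply: cvgM; first exact: cvg_cst.
  by apply: cvgM; [exact: cvg_cst | apply: dotv_cvg; exact: cvg_fst].
Qed.

End FunctionClass.

(** * Translation of functions and subdifferentials *)

Section Shift.
Variables (R : realType) (n : nat).
Implicit Types (f g : 'cV[R]_n -> \bar R) (b h w x : 'cV[R]_n) (a t m : R).

(** The quadratic forms m q(x + b) and m q(x) differ by an affine function of x,
    so both defining conditions of the class reduce to [pcc_shift]. *)
Lemma classS_shift m (L : \bar R) f b w a : classS m L f ->
  classS m L (fun x => f (x + b)%R + (a - dotv w x)%:E)%E.
Proof.
case=> fm fL; split=> [|l lL].
  have := pcc_shift b (m *: b - w) (a + m * qform b) fm.
  congr pcc; apply/funext => x; case: (f (x + b)) => [r| |] //=.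
  by congr EFin; rewrite qformD dotvDl dotvNl dotvZl; ring.
have := pcc_shift b (w - l *: b) (- a - l * qform b) (fL l lL).
congr pcc; apply/funext => x; case: (f (x + b)) => [r| |] //=.
by congr EFin; rewrite qformD dotvDl dotvNl dotvZl; ring.
Qed.

Lemma convex_subdiff_shift g b h a x k :
  convex_subdiff (fun x => g (x + b)%R + (dotv h x + a)%:E)%E x k <->
  convex_subdiff g (x + b) (k - h).
Proof.
have step u v : (g (u + b)%R + (dotv h u + a)%:E + (dotv k (v - u))%:E <=
      g (v + b)%R + (dotv h v + a)%:E)%E =
    (g (u + b)%R + (dotv (k - h) (v + b - (u + b)))%:E <= g (v + b)%R)%E.
  have -> : v + b - (u + b) = v - u by rewrite opprD addrACA subrr addr0.
  case: (g (u + b)) (g (v + b)) => [r| |] [r'| |];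
    rewrite ?addye ?addNye ?leey ?leNye //.
  rewrite -!EFinD !lee_fin dotvDl dotvNl !dotvDr !dotvNr.
  by apply/idP/idP => ?; lra.
split=> [gk y|gk y].
  by have := gk (y - b); rewrite step subrK.
by rewrite step; exact: gk.
Qed.

Lemma subdiff_shift m f b w a x v :
  subdiff m (fun x => f (x + b)%R + (a - dotv w x)%:E)%E x v <->
  subdiff m f (x + b) (v + w).
Proof.
pose g y := (f y - (m * qform y)%:E)%E.
have gE : (fun y => f (y + b)%R + (a - dotv w y)%:E - (m * qform y)%:E)%E =
    (fun y => g (y + b)%R + (dotv (m *: b - w) y + (a + m * qform b))%:E)%E.
  apply/funext => y; rewrite /g; case: (f (y + b)) => [r| |] //=.
  by congr EFin; rewrite qformD dotvDl dotvNl dotvZl; ring.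
rewrite /subdiff /= gE; split=> -[k gk E].
  exists (k - (m *: b - w)); first by have /convex_subdiff_shift := gk.
  by rewrite -E scalerDr opprB; apply/colP => i; rewrite !mxE; ring.
exists (k + (m *: b - w)).
  by apply/convex_subdiff_shift; rewrite addrK.
by rewrite -[v](addrK w) -E scalerDr; apply/colP => i; rewrite !mxE; ring.
Qed.

(** The lower extreme of the class: f - m q is zero, and l q - f is a
    nonnegative multiple of q. *)
Lemma classS_qform m (L : \bar R) : (m%:E < L)%E ->
  classS m L (fun x : 'cV[R]_n => (m * qform x)%:E).
Proof.
move=> mL; split=> [|l lL].
  have := @pcc_quadratic R n 0 (lexx 0).
  by congr pcc; apply/funext => x; rewrite -EFinB subrr mul0r.
have := @pcc_quadratic R n (l - m); rewrite subr_ge0.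
have -> : m <= l by apply: ltW; rewrite lL lte_fin in mL.
move=> /(_ isT); congr pcc; apply/funext => x.
by rewrite -EFinB mulrBl.
Qed.

(** A linear functional bounded above by zero vanishes, so the constant 0 has
    only the zero subgradient. *)
Lemma subdiff_qform m x v :
  subdiff m (fun x : 'cV[R]_n => (m * qform x)%:E) x v <-> v = m *: x.
Proof.
have g0 : (fun y : 'cV[R]_n => (m * qform y)%:E - (m * qform y)%:E)%E =
    (fun=> 0%E) by apply/funext => y; rewrite -EFinB subrr.
rewrite /subdiff /= g0; split=> [[k k0 <-]|->].
  have := k0 (x + k); rewrite /= add0e lee_fin addrC addKr => /dotv_eq0 ->.
  by rewrite add0r.
by exists 0; rewrite ?add0r// => y /=; rewrite dotv0l adde0.
Qed.

(** If f were +oo at x, the subgradient inequality would make it +oo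
    everywhere, against properness. *)
Lemma subdiff_fin_num m (L : \bar R) f x v :
  classS m L f -> subdiff m f x v -> f x \is a fin_num.
Proof.
move=> [[[fNy [y fy]] _ _] _] [k /(_ y) fk _]; move: (fNy x) fy fk.
by case: (f x) (f y) => [r| |] [r'| |].
Qed.

End Shift.

(** * Blocks of stacked vectors *)

Section Blocks.
Variables (R : realType) (s c : nat).
Implicit Types (z w v : 'cV[R]_(s * c)) (b : 'cV[R]_c).

Lemma blkD i z w : blk i (z + w) = blk i z + blk i w.
Proof. by apply/colP => j; rewrite !mxE. Qed.

Lemma blkN i z : blk i (- z) = - blk i z.
Proof. by apply/colP => j; rewrite !mxE. Qed.

Lemma blk0 i : blk i (0 : 'cV[R]_(s * c)) = 0.
Proof. by apply/colP => j; rewrite !mxE. Qed.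

Lemma blk_inj z w : (forall i, blk i z = blk i w) -> z = w.
Proof.
move=> zw; apply/colP => k; rewrite -(mxtens_unindexK k).
by case: (mxtens_unindex k) => i j; have /colP/(_ j) := zw i; rewrite !mxE.
Qed.

Lemma onesIE (i : 'I_s) (j j' : 'I_c) :
  onesI R s c (mxtens_index (i, j)) j' = (j == j')%:R.
Proof.
have -> : onesI R s c (mxtens_index (i, j)) j' =
    ((const_mx 1 : 'cV[R]_s) *t (1%:M : 'M[R]_c))
      (mxtens_index (i, j)) (mxtens_index (ord0, j')).
  rewrite /onesI castmxE /=; congr (_ _ _); last exact/val_inj.
  exact/val_inj.
by rewrite tensmxE !mxE mul1r.
Qed.

Lemma blk_stack i b : blk i (stack s b) = b.
Proof.
apply/colP => j; rewrite !mxE (bigD1 j)//= onesIE eqxx mul1r.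
by rewrite big1 ?addr0// => k kj; rewrite onesIE eq_sym (negbTE kj) mul0r.
Qed.

Lemma onesI_mul w : (onesI R s c)^T *m w = \sum_i blk i w.
Proof.
apply/colP => j; rewrite summxE mxE.
rewrite (reindex (@mxtens_index s c)) /=; last first.
  by exists (@mxtens_unindex s c) => k _; rewrite ?mxtens_indexK ?mxtens_unindexK.
transitivity (\sum_i \sum_k (onesI R s c)^T j (mxtens_index (i, k)) *
    w (mxtens_index (i, k)) 0).
  by rewrite pair_bigA; apply: eq_bigr => -[i k] _.
apply: eq_bigr => i _; rewrite mxE (bigD1 j)//= mxE onesIE eqxx mul1r.
by rewrite big1 ?addr0// => k kj; rewrite mxE onesIE (negbTE kj) mul0r.
Qed.

Lemma stackD b b' : stack s (b + b') = stack s b + stack s b'.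
Proof. exact: mulmxDr. Qed.

Lemma stack0 : stack s (0 : 'cV[R]_c) = 0.
Proof. exact: mulmx0. Qed.

End Blocks.

(** * Translation of operators *)

Section OperatorShift.
Variables (R : realType) (s c : nat).
Implicit Types (F : operator R (s * c)) (b : 'cV[R]_c) (w : 'cV[R]_(s * c)).

Definition shift_op F b w : operator R (s * c) :=
  fun z => [set v | F (z + stack s b) (v + w)].

Lemma optimal_shift F b w b' w' : \sum_i blk i w = 0 ->
  optimal_solution (shift_op F b w) b' w' <->
  optimal_solution F (b' + b) (w' + w).
Proof.
move=> w0; rewrite /optimal_solution /shift_op /= stackD.
under [X in _ <-> X = _ /\ _]eq_bigr do rewrite blkD.
by rewrite big_split /= w0 addr0.
Qed.

Lemma has_unique_optimum_shift F b w : \sum_i blk i w = 0 ->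
  has_unique_optimum F -> has_unique_optimum (shift_op F b w).
Proof.
move=> w0 [[b0 v0] [/= opt uniq]]; exists (b0 - b, v0 - w); split=> /=.
  by apply/optimal_shift; rewrite // !subrK.
move=> [b1 v1] /= /(optimal_shift _ _ _ _ w0)/(uniq (_, _)) [-> ->].
by rewrite !addrK.
Qed.

Lemma separable_subdiff_shift (m : 'I_s -> R) (f : 'I_s -> 'cV[R]_c -> \bar R)
    b w (a : 'I_s -> R) :
  shift_op (separable_subdiff m f) b w =
  separable_subdiff m
    (fun i x => f i (x + b)%R + (a i - dotv (blk i w) x)%:E)%E.
Proof.
apply/funext => z; apply/seteqP; split=> v fv i; have := fv i.
  by rewrite !blkD blk_stack => ?; apply/subdiff_shift.
by rewrite !blkD blk_stack => /subdiff_shift.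
Qed.

Lemma classO_shift (m : 'I_s -> R) (L : 'I_s -> \bar R) F b w :
  \sum_i blk i w = 0 -> classO m L F -> classO m L (shift_op F b w).
Proof.
move=> w0 [f [fS -> fu]].
exists (fun i x => f i (x + b)%R + (0 - dotv (blk i w) x)%:E)%E; split.
- by move=> i; exact: classS_shift.
- exact: separable_subdiff_shift.
- exact: has_unique_optimum_shift.
Qed.

(** The constant added to f_i is - f_i(b), which is a real number because f_i
    has a subgradient at b. *)
Lemma classO0_shift (m : 'I_s -> R) (L : 'I_s -> \bar R) F b w :
  classO m L F -> optimal_solution F b w -> classO0 m L (shift_op F b w).
Proof.
move=> [f [fS FE fu]] [w0 Fbw]; rewrite {}FE in fu Fbw *.
exists (fun i x => f i (x + b)%R + (- fine (f i b) - dotv (blk i w) x)%:E)%E.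
split.
- by move=> i; exact: classS_shift.
- exact: separable_subdiff_shift.
- exact: has_unique_optimum_shift.
- move=> i; have := Fbw i; rewrite blk_stack => /(subdiff_fin_num (fS i)).
  by rewrite add0r dotv0r subr0 => /fineK <-; rewrite -EFinD subrr.
- by rewrite /shift_op /= !add0r.
Qed.

Lemma classO0_sub (m : 'I_s -> R) (L : 'I_s -> \bar R) F :
  classO0 m L F -> classO m L F.
Proof. by move=> [f [? ? ? _ _]]; exists f. Qed.

(** The witness is the linear operator multiplying the i-th block by m_i.  An optimal pair (b, w)
    satisfies w_i = m_i b and (sum of the m_i) b = 0, hence is zero. *)
Lemma classO0_inhabited (m : 'I_s -> R) (L : 'I_s -> \bar R) :
  (forall i, ((m i)%:E < L i)%E) -> 0 < \sum_i m i ->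
  exists F, classO0 m L F.
Proof.
move=> mL m0; pose f i (x : 'cV[R]_c) := (m i * qform x)%:E.
have fE z w : separable_subdiff m f z w <-> forall i, blk i w = m i *: blk i z.
  by split=> fw i; apply/subdiff_qform; exact: fw.
exists (separable_subdiff m f), f; split=> //.
- by move=> i; exact: classS_qform.
- exists (0, 0); split=> /=.
    split; first by rewrite big1// => i _; rewrite blk0.
    by apply/fE => i; rewrite stack0 !blk0 scaler0.
  move=> [b w] [/= w0 /fE wb].
  have b0 : b = 0.
    move: w0; under eq_bigr do rewrite wb blk_stack.
    rewrite -scaler_suml => /eqP; rewrite scaler_eq0 (gt_eqF m0)/=.
    by move/eqP.
  by rewrite b0; congr (_, _); apply: blk_inj => i;
    rewrite wb b0 stack0 blk0 scaler0.
- by move=> i; rewrite /f /qform dotv0l !mulr0.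
- by apply/fE => i; rewrite !blk0 scaler0.
Qed.

Lemma optimum0 (m : 'I_s -> R) (L : 'I_s -> \bar R) F :
  classO0 m L F -> optimal_solution F 0 0.
Proof.
move=> [f [_ _ _ _ F0]]; split; last by rewrite stack0.
by rewrite big1// => i _; rewrite blk0.
Qed.

End OperatorShift.

(** * The closed loop *)

Section ClosedLoop.
Variables (R : realType) (n q nu ny nc : nat).
Variables (P : network R n q nu ny) (K : controller R nc nu ny).

(** The signals y and u after elimination.  They are defined on matrices, so
    that the same formulas serve trajectories and regulator equations. *)
Definition loop_output p (X : 'M[R]_(n + nc, p)) (W : 'M[R]_(q, p)) :
    'M[R]_(ny, p) :=
  invmx (1%:M - nD2 P *m kD K) *m
    (nC2 P *m usubmx X + nD2 P *m kC K *m dsubmx X + nD21 P *m W).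

Definition loop_input p (X : 'M[R]_(n + nc, p)) (W : 'M[R]_(q, p)) :
    'M[R]_(nu, p) :=
  kC K *m dsubmx X + kD K *m loop_output X W.

Lemma loop_outputP p (X : 'M[R]_(n + nc, p)) W Y U :
  loop_well_posed P K ->
  (nC2 P *m usubmx X + nD21 P *m W + nD2 P *m U = Y /\
   kC K *m dsubmx X + kD K *m Y = U) <->
  (Y = loop_output X W /\ U = loop_input X W).
Proof.
move=> wp; rewrite /loop_input; split=> [[EY EU]|[-> ->]].
  suff YE : Y = loop_output X W by rewrite -YE EU.
  rewrite -[LHS](mulKmx wp); congr (_ *m _).
  rewrite mulmxBl mul1mx -{1}EY -EU mulmxDr !mulmxA.
  by rewrite addrA addrK addrAC.
split=> //; set V := loop_output X W.
have : (1%:M - nD2 P *m kD K) *m V =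
  nC2 P *m usubmx X + nD2 P *m kC K *m dsubmx X + nD21 P *m W by rewrite mulKVmx.
rewrite mulmxBl mul1mx => /(canRL (subrK _)) {2}->.
by rewrite mulmxDr !mulmxA !addrA; congr (_ + _); rewrite addrAC.
Qed.

Lemma row_mx_mul p r (A : 'M[R]_(r, n)) (B : 'M[R]_(r, nc)) (X : 'M[R]_(n + nc, p)) :
  row_mx A B *m X = A *m usubmx X + B *m dsubmx X.
Proof. by rewrite -mul_row_col vsubmxK. Qed.

Lemma loop_outputE p (X : 'M[R]_(n + nc, p)) W :
  let M := invmx (1%:M - nD2 P *m kD K) in
  row_mx (M *m nC2 P) (M *m nD2 P *m kC K) *m X + M *m nD21 P *m W =
  loop_output X W.
Proof. by rewrite /loop_output /= row_mx_mul !mulmxDr !mulmxA. Qed.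

Lemma loop_inputE p (X : 'M[R]_(n + nc, p)) W :
  let M := invmx (1%:M - nD2 P *m kD K) in
  (row_mx 0 (kC K) + kD K *m row_mx (M *m nC2 P) (M *m nD2 P *m kC K)) *m X +
    kD K *m (M *m nD21 P) *m W = loop_input X W.
Proof.
rewrite /loop_input /= -loop_outputE mulmxDl row_mx_mul mul0mx add0r.
by rewrite [kD K *m (_ + _)]mulmxDr -!mulmxA addrA.
Qed.

Lemma clAE p (X : 'M[R]_(n + nc, p)) W :
  clA P K *m X + clB P K *m W =
  col_mx (nA P *m usubmx X + nB1 P *m W + nB2 P *m loop_input X W)
         (kA K *m dsubmx X + kB K *m loop_output X W).
Proof.
rewrite /clA /clB !mul_col_mx add_col_mx -loop_inputE -loop_outputE /=.
congr col_mx.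
  rewrite [in RHS]mulmxDr !(mulmxA (nB2 P)) 2!mulmxDl.
  by rewrite row_mx_mul mul0mx addr0 addrACA !addrA.
rewrite [in RHS]mulmxDr !(mulmxA (kB K)) mulmxDl.
by rewrite row_mx_mul mul0mx add0r !addrA.
Qed.

Lemma clCE p (X : 'M[R]_(n + nc, p)) W :
  clC P K *m X + clD P K *m W =
  nC1 P *m usubmx X + nD1 P *m W + nD12 P *m loop_input X W.
Proof.
rewrite /clC /clD -loop_inputE /= mulmxDr !(mulmxA (nD12 P)) 2!mulmxDl.
by rewrite row_mx_mul mul0mx addr0 addrACA !addrA.
Qed.

Lemma trajectory_of_eqs (F : operator R q) xN xi w z u y :
  loop_well_posed P K ->
  network_eqs P xN w z u y -> controller_eqs K xi y u ->
  (forall k, F (z k) (w k)) ->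
  trajectory P K F (fun k => col_mx (xN k) (xi k)) w z /\
  forall k, y k = loop_output (col_mx (xN k) (xi k)) (w k) /\
    u k = loop_input (col_mx (xN k) (xi k)) (w k).
Proof.
move=> wp net con Fwz.
have yu k : y k = loop_output (col_mx (xN k) (xi k)) (w k) /\
    u k = loop_input (col_mx (xN k) (xi k)) (w k).
  have [_ _ Ey] := net k; have [_ Eu] := con k.
  by apply/loop_outputP; rewrite ?col_mxKu ?col_mxKd.
split=> // k; rewrite clAE clCE col_mxKu col_mxKd.
have [<- <-] := yu k; have [-> Ez _] := net k; have [-> _] := con k.
by split=> //; rewrite -Ez.
Qed.

(** Since z - D w = C x and w is in F(z), the pair (w, C x) belongs to the graph
    of (F^-1 - D)^-1, which is a continuous function: w follows the state. *)
Lemma trajectory_cvg (F : operator R q) x w z xs ws zs :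
  well_posed P K F -> fixed_point P K F xs ws zs -> trajectory P K F x w z ->
  x k @[k --> \oo] --> xs ->
  w k @[k --> \oo] --> ws /\ z k @[k --> \oo] --> zs.
Proof.
move=> [_ [g gE g_cont]] [_ Ezs Fs] tr xk.
have resolventE x' w' z' : z' = clC P K *m x' + clD P K *m w' -> F z' w' ->
    w' = g (clC P K *m x').
  move=> Ez Fzw; have : loop_resolvent P K F (clC P K *m x') w'.
    by exists z' => //; rewrite Ez addrK.
  by rewrite gE.
have wE : w = fun k => g (clC P K *m x k).
  by apply/funext => k; have [_ Ez Fzw] := tr k; exact: resolventE Ez Fzw.
have wk : w k @[k --> \oo] --> ws.
  rewrite (resolventE _ _ _ Ezs Fs) wE.
  have Cxk : clC P K *m x k @[k --> \oo] --> clC P K *m xs by exact: cvg_mulmxr.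
  exact: (cvg_comp _ _ Cxk (g_cont _)).
split=> //; have -> : z = fun k => clC P K *m x k + clD P K *m w k.
  by apply/funext => k; have [_ ->] := tr k.
by rewrite Ezs; apply: cvg_addmx; exact: cvg_mulmxr.
Qed.

Lemma trajectory_cst (F : operator R q) x w z :
  fixed_point P K F x w z ->
  trajectory P K F (fun=> x) (fun=> w) (fun=> z).
Proof. by case=> ? ? ?; split. Qed.

Lemma loop_output_cvg (x : nat -> 'cV[R]_(n + nc)) w xs ws :
  x k @[k --> \oo] --> xs -> w k @[k --> \oo] --> ws ->
  loop_output (x k) (w k) @[k --> \oo] --> loop_output xs ws.
Proof.
move=> xk wk; apply: cvg_mulmxr; apply: cvg_addmx; last exact: cvg_mulmxr.
have -> : (fun k => nC2 P *m usubmx (x k) + nD2 P *m kC K *m dsubmx (x k)) =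
    (fun k => row_mx (nC2 P) (nD2 P *m kC K) *m x k).
  by apply/funext => k; rewrite -{3}[x k]vsubmxK mul_row_col.
by rewrite -mul_row_col vsubmxK; exact: cvg_mulmxr.
Qed.

Lemma loop_input_cvg (x : nat -> 'cV[R]_(n + nc)) w xs ws :
  x k @[k --> \oo] --> xs -> w k @[k --> \oo] --> ws ->
  loop_input (x k) (w k) @[k --> \oo] --> loop_input xs ws.
Proof.
move=> xk wk; apply: cvg_addmx; last by apply: cvg_mulmxr; exact: loop_output_cvg.
have -> : (fun k => kC K *m dsubmx (x k)) = (fun k => row_mx 0 (kC K) *m x k).
  by apply/funext => k; rewrite -{2}[x k]vsubmxK mul_row_col mul0mx add0r.
have -> : kC K *m dsubmx xs = row_mx 0 (kC K) *m xs.
  by rewrite -{2}[xs]vsubmxK mul_row_col mul0mx add0r.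
exact: cvg_mulmxr.
Qed.

Lemma loop_output_mul p r (X : 'M[R]_(n + nc, p)) W (V : 'M[R]_(p, r)) :
  loop_output X W *m V = loop_output (X *m V) (W *m V).
Proof.
rewrite /loop_output -[LHS]mulmxA; congr (_ *m _).
by rewrite 2!mulmxDl -!mulmxA mul_usub_mx mul_dsub_mx.
Qed.

Lemma loop_input_mul p r (X : 'M[R]_(n + nc, p)) W (V : 'M[R]_(p, r)) :
  loop_input X W *m V = loop_input (X *m V) (W *m V).
Proof.
rewrite /loop_input mulmxDl -(mulmxA (kC K)) -(mulmxA (kD K)).
by rewrite loop_output_mul mul_dsub_mx.
Qed.

End ClosedLoop.

(** * Robust stability and the regulator equations *)

Section Regulator.
Variables (R : realType) (s c n nu ny nc : nat).
Variables (P : network R n (s * c) nu ny) (K : controller R nc nu ny).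
Implicit Types (F : operator R (s * c)) (N : 'M[R]_(s * c, s.-1 * c)).

Lemma trajectory_shift F x w z xs ws b :
  trajectory P K F x w z -> fixed_point P K F xs ws (stack s b) ->
  trajectory P K (shift_op F b ws) (fun k => x k - xs) (fun k => w k - ws)
    (fun k => z k - stack s b).
Proof.
move=> tr [Ex Ez _] k; have [Exk Ezk Fk] := tr k; split.
- by rewrite Exk {1}Ex !mulmxBr opprD addrACA.
- by rewrite Ezk {1}Ez !mulmxBr opprD addrACA.
- by rewrite /shift_op /= !subrK.
Qed.

(** Robust stability applies to the operator translated to its optimum, whose
    trajectories are the deviations from the fixed point. *)
Lemma robust_convergent (m : 'I_s -> R) (L : 'I_s -> \bar R) F xs ws b x w z :
  well_posed P K F -> robust_stability P K m L -> classO m L F ->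
  optimal_solution F b ws -> fixed_point P K F xs ws (stack s b) ->
  trajectory P K F x w z ->
  [/\ x k @[k --> \oo] --> xs, w k @[k --> \oo] --> ws
    & z k @[k --> \oo] --> stack s b].
Proof.
move=> wpF [_ rob] FO opt fp tr.
have [_ stab] := rob _ (classO0_shift FO opt).
have xk : x k @[k --> \oo] --> xs.
  have := stab _ _ _ (trajectory_shift tr fp) => xk0.
  have := cvg_addmx _ xk0 (cvg_cst xs); rewrite add0r.
  by under eq_cvg do rewrite subrK; apply.
by have [] := trajectory_cvg wpF fp tr xk.
Qed.

(** For F in O^0 the origin is a fixed point, and its constant trajectory
    identifies the common limit. *)
Lemma convergent_robust (m : 'I_s -> R) (L : 'I_s -> \bar R) F x w z :
  convergent P K F -> classO0 m L F -> trajectory P K F x w z ->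
  x k @[k --> \oo] --> (0 : 'cV[R]_(n + nc)).
Proof.
move=> [xs [ws [zs [_ _ _ conv]]]] F0 /conv[xk _ _].
have fp0 : fixed_point P K F 0 0 0.
  by split; rewrite ?mulmx0 ?addr0//; case: F0 => f [].
have [/cst_cvg_mx x0 _ _] := conv _ _ _ (trajectory_cst fp0).
by rewrite x0.
Qed.

(** Applying convergence to a translate of the quadratic operator, whose optimal
    solution is the prescribed pair (b, w), gives an equilibrium state.  Any
    other equilibrium state for (b, w) is the limit of its own constant
    trajectory, hence the same. *)
Lemma convergent_fixed_point (m : 'I_s -> R) (L : 'I_s -> \bar R) b w :
  (forall i, ((m i)%:E < L i)%E) -> 0 < \sum_i m i ->
  (forall F, classO m L F -> convergent P K F) -> \sum_i blk i w = 0 ->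
  exists! x, x = clA P K *m x + clB P K *m w /\
    stack s b = clC P K *m x + clD P K *m w.
Proof.
move=> mL m0 conv w0; have [F0 F0O] := classO0_inhabited c mL m0.
have Nw0 : \sum_i blk i (- w) = 0.
  by under eq_bigr do rewrite blkN; rewrite sumrN w0 oppr0.
pose F := shift_op F0 (- b) (- w).
have FO : classO m L F by apply: classO_shift => //; exact: classO0_sub F0O.
have opt : optimal_solution F b w.
  by apply/optimal_shift; rewrite // !subrr; exact: optimum0 F0O.
have [xs [ws [zs [[Ex Ez Fs] [b' zsE] ws0 cv]]]] := conv _ FO.
have [p [_ uniq]] : has_unique_optimum F by case: FO => f [].
have opt' : optimal_solution F b' ws by rewrite /optimal_solution -onesI_mul -zsE.
have [bE wE] : (b, w) = (b', ws) by rewrite -(uniq (b, w) opt) (uniq (_, _) opt').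
rewrite {}zsE -bE -wE in Ex Ez Fs cv.
exists xs; split=> // x [Exx Exz].
have fx : fixed_point P K F x w (stack s b) by [].
by have [/cst_cvg_mx-> _ _] := cv _ _ _ (trajectory_cst fx).
Qed.

(** [exo_w] and [exo_z] express the optimal signals w and z as linear images of
    the exogenous vector (- beta, w_hat). *)
Definition exo_w N : 'M[R]_(s * c, c + s.-1 * c) := row_mx 0 N.
Definition exo_z : 'M[R]_(s * c, c + s.-1 * c) := row_mx (- onesI R s c) 0.

(** The matrix X = (Pi; Theta) plays the role of the state in a fixed point
    whose signals are [exo_w] and [exo_z]. *)
Lemma regulator_eqsE N Pi Theta Gamma Phi : loop_well_posed P K ->
  regulator_eqs P K N Pi Theta Gamma Phi <->
  let X := col_mx Pi Theta in
  [/\ X = clA P K *m X + clB P K *m exo_w N,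
      exo_z = clC P K *m X + clD P K *m exo_w N,
      Phi = loop_output P K X (exo_w N)
    & Gamma = loop_input P K X (exo_w N)].
Proof.
move=> wp /=; rewrite clAE clCE.
have WE r (M : 'M[R]_(r, s * c)) : M *m exo_w N = row_mx 0 (M *m N).
  by rewrite mul_mx_row mulmx0.
have ZE : row_mx (onesI R s c) (nD1 P *m N) = row_mx 0 (nD1 P *m N) - exo_z.
  by rewrite opp_row_mx add_row_mx opprK oppr0 add0r addr0.
split=> [[E1 E2 E3 E4 E5]|[E1 E2 E3 E4]].
  have [EY EU] : Phi = loop_output P K (col_mx Pi Theta) (exo_w N) /\
      Gamma = loop_input P K (col_mx Pi Theta) (exo_w N).
    by apply/loop_outputP => //; rewrite col_mxKu col_mxKd WE.
  split=> //; rewrite -EU -?EY ?col_mxKu ?col_mxKd ?WE.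
    by rewrite E1 E4.
  apply/eqP; rewrite eq_sym -subr_eq0 -[X in _ == X]E2 ZE.
  by rewrite addrA [eqbLHS]addrAC.
have [EY EU] : nC2 P *m usubmx (col_mx Pi Theta) + nD21 P *m exo_w N +
    nD2 P *m Gamma = Phi /\
    kC K *m dsubmx (col_mx Pi Theta) + kD K *m Phi = Gamma.
  by apply/loop_outputP.
move: E1 E2 EY EU; rewrite -E3 -E4 col_mxKu col_mxKd !WE.
move=> /eq_col_mx[E1 E1'] E2 EY EU; split=> //.
by rewrite ZE [X in X + _ = 0]addrA [LHS]addrAC -E2 subrr.
Qed.

Lemma exo_w_mul N (b : 'cV[R]_c) (w : 'cV[R]_(s.-1 * c)) :
  exo_w N *m col_mx (- b) w = N *m w.
Proof. by rewrite mul_row_col mul0mx add0r. Qed.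

Lemma exo_z_mul (b : 'cV[R]_c) (w : 'cV[R]_(s.-1 * c)) :
  exo_z *m col_mx (- b) w = stack s b.
Proof. by rewrite mul_row_col mulNmx mulmxN opprK mul0mx addr0. Qed.

Lemma regulator_fixed_point N Pi Theta Gamma Phi F (b : 'cV[R]_c)
    (w : 'cV[R]_(s.-1 * c)) : loop_well_posed P K ->
  regulator_eqs P K N Pi Theta Gamma Phi -> F (stack s b) (N *m w) ->
  fixed_point P K F (col_mx Pi Theta *m col_mx (- b) w) (N *m w) (stack s b).
Proof.
move=> wp /(regulator_eqsE _ _ _ _ _ wp)[E1 E2 _ _] Fw; split=> //.
  by rewrite {1}E1 mulmxDl -!mulmxA exo_w_mul.
by rewrite -(exo_z_mul b w) E2 mulmxDl -!mulmxA exo_w_mul.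
Qed.

Lemma mx_eq_delta p r (A B : 'M[R]_(p, r)) :
  (forall j, A *m delta_mx j 0 = B *m delta_mx j 0 :> 'cV[R]_p) -> A = B.
Proof.
by move=> AB; apply/matrixP => i j; have /colP/(_ i) := AB j; rewrite -!colE !mxE.
Qed.

Lemma exists_unique_by_columns p q r t (M1 : 'M[R]_p) (M2 : 'M[R]_(t, p))
    (D1 : 'M[R]_(p, q)) (D2 : 'M[R]_(t, q)) (W : 'M[R]_(q, r)) (Z : 'M[R]_(t, r)) :
  (forall v : 'cV[R]_r, exists! x : 'cV[R]_p,
    x = M1 *m x + D1 *m (W *m v) /\ Z *m v = M2 *m x + D2 *m (W *m v)) ->
  exists! X : 'M[R]_(p, r), X = M1 *m X + D1 *m W /\ Z = M2 *m X + D2 *m W.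
Proof.
move=> sol; have [f fP] := choice sol.
pose X : 'M[R]_(p, r) := \matrix_(i, j) f (delta_mx j 0) i 0.
have XE j : X *m delta_mx j 0 = f (delta_mx j 0).
  by rewrite -colE; apply/colP => i; rewrite !mxE.
exists X; split.
  split; apply: mx_eq_delta => j; rewrite mulmxDl -!mulmxA XE;
    by have [[]] := fP (delta_mx j 0).
move=> X' [E1 E2]; apply: mx_eq_delta => j; rewrite XE.
have [_] := fP (delta_mx j 0); apply; split.
  by rewrite {1}E1 mulmxDl -!mulmxA.
by rewrite {1}E2 mulmxDl -!mulmxA.
Qed.

Lemma convergent_regulator (m : 'I_s -> R) (L : 'I_s -> \bar R) N :
  loop_well_posed P K ->
  (forall i, ((m i)%:E < L i)%E) -> 0 < \sum_i m i ->
  (forall w : 'cV[R]_(s.-1 * c), (onesI R s c)^T *m (N *m w) = 0) ->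
  (forall F, classO m L F -> convergent P K F) -> regulator_condition P K N.
Proof.
move=> wp mL m0 N0 conv.
have [X [[E1 E2] uniq]] : exists! X : 'M[R]_(n + nc, c + s.-1 * c),
    X = clA P K *m X + clB P K *m exo_w N /\
    exo_z = clC P K *m X + clD P K *m exo_w N.
  apply: exists_unique_by_columns => v.
  rewrite -[v]vsubmxK -[usubmx v]opprK exo_w_mul exo_z_mul.
  by apply: (convergent_fixed_point _ mL m0 conv); rewrite -onesI_mul.
exists (usubmx X, dsubmx X, loop_input P K X (exo_w N),
  loop_output P K X (exo_w N)); split.
  by apply/regulator_eqsE => //=; rewrite vsubmxK.
move=> [[[Pi Theta] Gamma] Phi] /(regulator_eqsE _ _ _ _ _ wp)[E1' E2' -> ->].
by rewrite (uniq (col_mx Pi Theta)) // col_mxKu col_mxKd.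
Qed.

End Regulator.

(** * The convergence theorem *)

Theorem theorem4p2 (R : realType) (s c n nu ny nc : nat)
    (m : 'I_s -> R) (L : 'I_s -> \bar R)
    (P : network R n (s * c) nu ny)
    (N : 'M[R]_(s * c, s.-1 * c))
    (K : controller R nc nu ny)
    (s_ge1 : (1 <= s)%N) (c_ge1 : (1 <= c)%N)
    (mL : forall i, ((m i)%:E < L i)%E)
    (sum_m_gt0 : 0 < \sum_i m i)
    (N_consensus : consensus_matrix N)
    (assumption1 : shift_invertible P m)
    (assumption2 : shift_stabilizable_detectable P m)
    (wp : forall F, classO m L F -> well_posed P K F) :
  ((forall F, classO m L F -> convergent P K F) <->
   (robust_stability P K m L /\ regulator_condition P K N))
  /\
  (robust_stability P K m L -> regulator_condition P K N ->
   forall Pi Theta Gamma Phi, regulator_eqs P K N Pi Theta Gamma Phi ->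
   forall F, classO m L F ->
   forall (beta : 'cV[R]_c) (w_opt : 'cV[R]_(s * c))
     (w_hat : 'cV[R]_(s.-1 * c)),
   optimal_solution F beta w_opt -> w_opt = N *m w_hat ->
   forall (xN : nat -> 'cV[R]_n) (xi : nat -> 'cV[R]_nc)
     (w z : nat -> 'cV[R]_(s * c))
     (u : nat -> 'cV[R]_nu) (y : nat -> 'cV[R]_ny),
   network_eqs P xN w z u y -> controller_eqs K xi y u ->
   (forall k, F (z k) (w k)) ->
   (col_mx (col_mx (xN k) (xi k)) (col_mx (y k) (u k))
      @[k --> \oo] -->
      col_mx (col_mx Pi Theta) (col_mx Phi Gamma) *m col_mx (- beta) w_hat)
   /\
   (col_mx (z k) (w k)
      @[k --> \oo] --> col_mx (stack s beta) (N *m w_hat))).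
Proof.
have [_ ranN] := N_consensus.
have N0 (w : 'cV[R]_(s.-1 * c)) : (onesI R s c)^T *m (N *m w) = 0.
  suff : range (fun v : 'cV[R]_(s.-1 * c) => N *m v) (N *m w) by rewrite ranN.
  by exists w.
have lwp : loop_well_posed P K.
  have [F0 /classO0_sub F0O] := classO0_inhabited c mL sum_m_gt0.
  by have [] := wp _ F0O.
split; [split=> [conv|[rob reg] F FO]|].
- split; last exact: convergent_regulator conv.
  split=> // F F0; have FO := classO0_sub F0; split; first exact: wp.
  by move=> x w z; exact: convergent_robust (conv _ FO) F0.
- have [f [_ _ [[b ws] [/= opt _]]]] := FO.
  have [[[[Pi Theta] Gamma] Phi] [regE _]] := reg.
  have ws0 : (onesI R s c)^T *m ws = 0 by rewrite onesI_mul; case: opt.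
  have [wh _ whE] : range (fun v : 'cV[R]_(s.-1 * c) => N *m v) ws by rewrite ranN.
  have fp : fixed_point P K F (col_mx Pi Theta *m col_mx (- b) wh) ws (stack s b).
    rewrite -whE; apply: regulator_fixed_point regE _ => //.
    by rewrite whE; case: opt.
  exists (col_mx Pi Theta *m col_mx (- b) wh), ws, (stack s b).
  split=> //; first by exists b.
  by move=> x w z; exact: robust_convergent (wp _ FO) rob FO opt fp.
- move=> rob _ Pi Theta Gamma Phi regE F FO b ws wh opt wsE.
  move=> xN xi w z u y net con Fzw.
  have [tr yu] := trajectory_of_eqs lwp net con Fzw.
  rewrite {ws}wsE in opt.
  have fp : fixed_point P K F (col_mx Pi Theta *m col_mx (- b) wh) (N *m wh)
      (stack s b).
    by apply: regulator_fixed_point regE _ => //; case: opt.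
  have [xk wk zk] := robust_convergent (wp _ FO) rob FO opt fp tr.
  split; last exact: cvg_col_mx.
  have /regulator_eqsE[//|_ _ -> ->] := regE.
  rewrite mul_col_mx; apply: cvg_col_mx => //.
  rewrite mul_col_mx loop_output_mul loop_input_mul exo_w_mul.
  apply: cvg_col_mx.
    under eq_cvg do rewrite (yu _).1.
    exact: loop_output_cvg.
  under eq_cvg do rewrite (yu _).2.
  exact: loop_input_cvg.
Qed.
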